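(* If $T$ is a finite tournament, then $D'(T) \le 2$.
   Context: A tournament is a complete oriented graph: a digraph $T$ with vertex set $V(T)$ and arc set $A(T)$ (no loops) such that for all distinct $u,v\in V(T)$ exactly one of $uv$, $vu$ belongs to $A(T)$. $Aut(T)$ denotes the automorphism group of $T$; the identity is called the trivial automorphism. An arc labeling of a digraph $G$ with $d$ labels is a total function $\phi: A(G)\to L$ with $|L|=d$ (not required to be surjective). An automorphism $\sigma\in Aut(G)$ preserves $\phi$ if $\phi(uv)=\phi(\sigma(u)\sigma(v))$ for every arc $uv\in A(G)$. The labeling $\phi$ is $d$-distinguishing if it uses $d$ labels and no nontrivial automorphism of $G$ preserves it. The distinguishing index $D'(G)$ is the least cardinal $d$ such that $G$ has a $d$-distinguishing arc labeling. *)

(* Defs.v *)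
From HB Require Import structures.
From mathcomp Require Import all_boot all_fingroup.

Set Implicit Arguments.
Unset Strict Implicit.
Unset Printing Implicit Defensive.

Record digraph := Digraph {
  vertex :> finType;
  arc : rel vertex;
  arc_irr : irreflexive arc
}.

Record tournament := Tournament {
  tdigraph :> digraph;
  arc_total : forall u v : tdigraph, u != v -> arc u v (+) arc v u
}.

Section Distinguishing.

Variable G : digraph.

Definition arcs : finType := {a : G * G | arc a.1 a.2}.

Definition digraph_aut : {set {perm G}} :=
  [set s : {perm G} | [forall u, forall v, arc (s u) (s v) == arc u v]].

Definition arc_labeling (d : nat) := {ffun arcs -> 'I_d}.

(* When s is an automorphism, every arc a has exactly one image arc b, so the
   universal quantification over b amounts to phi (u, v) = phi (s u, s v). *)
Definition preserves (d : nat) (s : {perm G}) (phi : arc_labeling d) : bool :=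
  [forall a : arcs, forall b : arcs,
     (val b == (s (val a).1, s (val a).2)) ==> (phi a == phi b)].

Definition distinguishing (d : nat) (phi : arc_labeling d) : bool :=
  [forall s in digraph_aut, preserves s phi ==> (s == 1%g)].

Definition distinguishable (d : nat) : bool :=
  [exists phi : arc_labeling d, distinguishing phi].

(* A digraph with two isolated vertices has no distinguishing arc labeling at
   all, so the index is defined from a proof that one exists. As G is finite,
   finite cardinals suffice: a labeling takes at most #|arcs| values. *)
Definition distinguishing_index (exG : exists d, distinguishable d) : nat :=
  ex_minn exG.

End Distinguishing.

Lemma tournament_distinguishable (T : tournament) :
  exists d, distinguishable T d.
Proof.
exists #|arcs T|; apply/existsP; exists [ffun a => enum_rank a].
apply/forall_inP => s; rewrite inE => /forallP sP; apply/implyP => /forallP pP.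
have fixarc u v : arc u v -> s u = u /\ s v = v.
  move=> uv; have suv : arc (s u) (s v) by move/forallP: (sP u) => /(_ v)/eqP->.
  pose a : arcs T := exist (fun a : T * T => arc a.1 a.2) (u, v) uv.
  pose b : arcs T := exist (fun a : T * T => arc a.1 a.2) (s u, s v) suv.
  have /implyP/(_ (eqxx _)) := forallP (pP a) b.
  by rewrite !ffunE => /eqP/enum_rank_inj/(congr1 val)[<- <-].
apply/eqP/permP => u; rewrite perm1; apply/eqP; apply/negPn/negP => neq.
have := arc_total neq; case: (boolP (arc (s u) u)) => [/fixarc[_ /eqP]|_].
  by rewrite (negPf neq).
by move=> /= /fixarc[/eqP]; rewrite (negPf neq).
Qed.

(* Main.v *)
Require Import Defs.
From HB Require Import structures.
From mathcomp Require Import all_boot all_fingroup.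

(** Every tournament has a Hamiltonian path ([tournament_hamiltonian_path]).
    Give one label to the arcs joining consecutive vertices of such a path and
    the other label to all remaining arcs.  An automorphism that preserves this
    labeling maps consecutive vertices to consecutive vertices, hence shifts
    the positions of all vertices by the position of the image of the first
    one.  The image of the last vertex must still lie on the path, so the shift
    is zero and every vertex is fixed ([succ_index_perm_id]). *)

(** Merge sort needs transitivity to sort every pair, but totality alone makes
    neighbours in its output comparable.  Applied to the reflexive closure of
    the arc relation, it thus returns a Hamiltonian path. *)
Lemma tournament_hamiltonian_path (T : tournament) :
  exists2 p : seq T, perm_eq p (enum T) & sorted (@Defs.arc T) p.
Proof.
pose le (u v : T) := (u == v) || Defs.arc u v.
have le_total : total le.
  move=> u v; rewrite /le [v == u]eq_sym; case: (eqVneq u v) => //= uv.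
  by have := arc_total uv; case: (Defs.arc u v).
exists (sort le (enum T)); first by rewrite perm_sort.
set p := sort le (enum T).
have p_uniq : uniq p by rewrite sort_uniq enum_uniq.
case p0 : p => [|x0 q] //; rewrite -p0; apply/(sortedP x0) => i lti.
have /(sortedP x0)/(_ i lti) : sorted le p := sort_sorted le_total _.
by rewrite /le nth_uniq // ?(ltnW lti) // eqn_leq ltnn andbF.
Qed.

(** A finite directed path has no nontrivial automorphism; here the path is
    given by an enumeration, and [s] only needs to respect successors. *)
Lemma succ_index_perm_id (T : finType) (p : seq T) (s : {perm T}) :
    uniq p -> (forall x, x \in p) ->
    (forall u v, index v p = (index u p).+1 ->
                 index (s v) p = (index (s u) p).+1) ->
  s = 1%g.
Proof.
move=> p_uniq p_all s_succ; apply/permP => x; rewrite perm1.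
have lt_index y : index y p < size p by rewrite index_mem.
have shift i : i < size p -> index (s (nth x p i)) p = index (s (nth x p 0)) p + i.
  elim: i => [|i IHi] lti; first by rewrite addn0.
  rewrite addnS -IHi ?(ltnW lti) //; apply: s_succ.
  by rewrite !index_uniq // ltnW.
have p_gt0 : 0 < size p := leq_ltn_trans (leq0n _) (lt_index x).
(* The last vertex bounds the shift. *)
have shift0 : index (s (nth x p 0)) p = 0.
  have := lt_index (s (nth x p (size p).-1)).
  rewrite shift ?prednK // -{2}(prednK p_gt0) ltnS.
  by rewrite -{2}(add0n (size p).-1) leq_add2r leqn0 => /eqP.
have := shift _ (lt_index x); rewrite shift0 nth_index //.
by move/(congr1 (nth x p)); rewrite !nth_index.
Qed.

Lemma tournament_distinguishable2 (T : tournament) : distinguishable T 2.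
Proof.
have [p p_enum /sortedP p_path] := tournament_hamiltonian_path T.
have p_uniq : uniq p by rewrite (perm_uniq p_enum) enum_uniq.
have p_all x : x \in p by rewrite (perm_mem p_enum) mem_enum.
pose phi : arc_labeling T 2 :=
  [ffun a => inord (index (val a).2 p == (index (val a).1 p).+1)].
apply/existsP; exists phi; apply/forall_inP => s; rewrite inE => /forallP s_aut.
apply/implyP => /forallP s_phi; apply/eqP.
apply: (succ_index_perm_id _ p) => // u v uv.
have arc_uv : Defs.arc u v.
  have := p_path u (index u p); rewrite -uv !nth_index //; apply.
  by rewrite index_mem.
have arc_suv : Defs.arc (s u) (s v) by move/forallP: (s_aut u) => /(_ v)/eqP->.
pose a : arcs T := exist (fun a : T * T => Defs.arc a.1 a.2) (u, v) arc_uv.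
pose b : arcs T := exist (fun a : T * T => Defs.arc a.1 a.2) (s u, s v) arc_suv.
have /implyP/(_ (eqxx _)) := forallP (s_phi a) b.
rewrite !ffunE /= uv eqxx => /eqP/(congr1 val).
by rewrite /= !inordK ?ltnS ?leq_b1 //; case: eqP.
Qed.

Theorem corollary2 (T : tournament) :
  distinguishing_index (tournament_distinguishable T) <= 2.
Proof.
rewrite /distinguishing_index; case: ex_minnP => m _; apply.
exact: tournament_distinguishable2.
Qed.
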